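(* For every integer $n\ge 3$ such that $3\mid\binom n2$, \[ R(K_n,\mathbb{Z}_3)= \begin{cases} 11, & n\in\{3,7\},\\ n+4, & n\ge 6\text{ and }n\equiv 0\pmod 3,\\ n+3, & n\ge 4,\ n\equiv 1\pmod 3,\text{ and }n\ne 7. \end{cases} \]
   Context: $K_m$ denotes the complete graph on $m$ vertices. For a finite simple graph $H$ whose number of edges $e(H)$ is divisible by $3$, the zero-sum Ramsey number $R(H,\mathbb{Z}_3)$ is the least integer $N$ such that every edge labeling $w\colon E(K_N)\to\mathbb{Z}_3$ admits a copy $H'$ of $H$ in $K_N$ (a not necessarily induced subgraph isomorphic to $H$) with $\sum_{e\in E(H')}w(e)=0$ in $\mathbb{Z}_3$. *)

(* Defs.v *)
From HB Require Import structures.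
From mathcomp Require Import all_boot all_order all_algebra.

Set Implicit Arguments.
Unset Strict Implicit.
Unset Printing Implicit Defensive.

Import GRing.Theory.

Record sgraph := SGraph {
  vert :> finType;
  adj : rel vert;
  adj_sym : symmetric adj;
  adj_irrefl : irreflexive adj }.

(* An edge xy is encoded as the 2-element set {x, y}. *)
Definition edges (G : sgraph) : {set {set G}} :=
  [set e | [exists x : G, exists y : G, adj x y && (e == [set x; y])]].

Definition edge_type (G : sgraph) := {e : {set G} | e \in edges G}.

Definition complete_rel (m : nat) : rel 'I_m := fun x y => x != y.

Lemma complete_rel_sym m : symmetric (@complete_rel m).
Proof. by move=> x y; rewrite /complete_rel eq_sym. Qed.

Lemma complete_rel_irrefl m : irreflexive (@complete_rel m).
Proof. by move=> x; rewrite /complete_rel eqxx. Qed.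

Definition complete_graph (m : nat) : sgraph :=
  SGraph (@complete_rel_sym m) (@complete_rel_irrefl m).

(* (V, E) is a copy of H in G: a not necessarily induced subgraph of G, with
   vertex set V and edge set E, to which f is an isomorphism from H. *)
Definition is_copy (H G : sgraph) (V : {set G}) (E : {set {set G}}) : Prop :=
  E \subset edges G /\
  exists f : H -> G,
    [/\ injective f, f @: [set: H] = V & [set f @: e | e : {set H} in edges H] = E].

Definition zero_sum_unavoidable (H : sgraph) (N : nat) : Prop :=
  forall w : edge_type (complete_graph N) -> 'Z_3,
  exists (V : {set complete_graph N}) (E : {set {set complete_graph N}}),
    is_copy H V E /\
    (\sum_(e : edge_type (complete_graph N) | val e \in E) w e = 0)%R.

(* R(H, Z_3) = r. Meaningful for graphs H with 3 dividing #|edges H|. *)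
Definition is_zero_sum_ramsey (H : sgraph) (r : nat) : Prop :=
  zero_sum_unavoidable H r /\
  forall N : nat, zero_sum_unavoidable H N -> r <= N.

(* Main.v *)
(* For a labelling [a] of ordered pairs let F(S) be its sum over S x S, that is,
   twice the edge sum of S.  Nonzero squares in Z_3 equal 1, so if F vanishes on
   no k-subset of A, then the sum of F(S)^2 over these subsets is C(|A|, k); on
   the other hand F(S)^2 expands into monomials meeting at most 4 vertices, and
   the sum can be evaluated modulo 3.

   For n = 1 mod 3 and N = n + 3 = 3m + 1, having no zero-sum K_n gives
   m = (m - 1) F(V)^2, hence F(V) = 0 and 3 | m.  This excludes n = 4; for
   n >= 10 a zero-sum triangle of the labelling a(x,y) + d(x) + d(y), with d the
   weighted degree, is the complement of a zero-sum K_n.  For n = 7 and N = 11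
   the same identity gives F(V - v) = 0 for all v, and then the complement of a
   zero-sum K_4 is a zero-sum K_7.

   For n = 0 mod 3 and N = n + 4 = 3m + 1, consider complements of 4-subsets.
   The identity on 7-subsets shows that no 7-subset has a number of vertices v
   with F(V - v) <> 0 divisible by 3, so F(V - v) <> 0 for all v; the identity
   on V then reads m = m - 1. *)
Require Import Defs.
From HB Require Import structures.
From mathcomp Require Import all_boot all_order all_algebra.
From mathcomp Require Import ring zify.

Set Implicit Arguments.
Unset Strict Implicit.
Unset Printing Implicit Defensive.

Import GRing.Theory.
Local Open Scope ring_scope.

(** * Binomial coefficients modulo 3 *)

Lemma Z3_3 : 3%:R = 0 :> 'Z_3.
Proof. by apply/val_inj. Qed.

Lemma Z3_sqr (x : 'Z_3) : x ^+ 2 = (x != 0)%:R.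
Proof. by apply/eqP; case: x => -[|[|[|m]]] lt_m3. Qed.

Lemma Z3_natr3 n : (3 * n)%:R = 0 :> 'Z_3.
Proof. by rewrite natrM Z3_3 mul0r. Qed.

(** By Pascal's rule, raising the upper index N by 3 adds 3 (C(N, 2) + C(N, 1)) + 1. *)
Lemma Z3_bin3 m r : (r < 3)%N -> ('C(3 * m + r, 3))%:R = m%:R :> 'Z_3.
Proof.
move=> lt_r3; elim: m => [|m IHm]; first by case: r lt_r3 => [|[|[|r]]].
have -> : (3 * m.+1 + r = (3 * m + r).+3)%N by lia.
rewrite [X in X%:R](_ : _ = ('C(3 * m + r, 3) +
  3 * ('C(3 * m + r, 2) + 'C(3 * m + r, 1)) + 1)%N).
  by rewrite natrD natrD Z3_natr3 IHm addr0 natr1.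
by rewrite !binS !bin0; lia.
Qed.

Lemma Z3_bin2 m : ('C(3 * m + 2, 2))%:R = 1 :> 'Z_3.
Proof.
elim: m => [|m IHm]; first by [].
have -> : (3 * m.+1 + 2 = (3 * m + 2).+3)%N by lia.
rewrite [X in X%:R](_ : _ = ('C(3 * m + 2, 2) +
  3 * ('C(3 * m + 2, 1) + 1))%N).
  by rewrite natrD Z3_natr3 IHm addr0.
by rewrite !binS !bin0; lia.
Qed.

(** * Sums of squares over subsets *)

(** Removing U is a bijection onto the (k - |U|)-subsets of A minus U. The conditional guards
    against truncated subtraction. *)
Lemma card_supersets (V : finType) (A U : {set V}) k :
  U \subset A ->
  #|[set T : {set V} | [&& U \subset T, T \subset A & #|T| == k]]| =
    (if (#|U| <= k)%N then 'C(#|A| - #|U|, k - #|U|) else 0)%N.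
Proof.
move=> sUA; case: leqP => [le_Uk | lt_kU]; last first.
  apply: eq_card0 => T; rewrite !inE; apply/negP => /and3P[/subset_leq_card + _].
  by move=> leUT /eqP eqT; lia.
rewrite -(cardsDS sUA) -cards_draws.
rewrite -(card_in_imset (f := fun T => T :\: U)); last first.
  move=> T1 T2; rewrite !inE => /and3P[/setIidPr sU1 _ _] /and3P[/setIidPr sU2 _ _] eq12.
  by rewrite -(setID T1 U) -(setID T2 U) eq12 sU1 sU2.
apply: eq_card => T; apply/imsetP/idP => [[T1 + ->] | ].
  rewrite !inE => /and3P[sU1 s1A /eqP <-].
  by rewrite setSD //= cardsDS.
rewrite !inE subsetD => /andP[/andP[sTA dTU] /eqP cT].
exists (U :|: T); last first.
  by rewrite setDUl setDv set0U; apply/esym/setDidPl.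
rewrite inE subsetUl subUset sUA sTA /= cardsU.
by move: dTU; rewrite -setI_eq0 setIC => /eqP->; rewrite cards0 cT; apply/eqP; lia.
Qed.

(** The diagonal is included because [codegree_form] stores data there. On a symmetric form with
    zero diagonal the value is twice, that is minus, the edge sum. *)
Definition quad (V : finType) (a : V -> V -> 'Z_3) (S : {set V}) : 'Z_3 :=
  \sum_(x in S) \sum_(y in S) a x y.

Definition quadruple (V : finType) (p : (V * V) * (V * V)) : {set V} :=
  [set p.1.1; p.1.2; p.2.1; p.2.2].

Section SumOfSquares.
Variables (V : finType) (a : V -> V -> 'Z_3).
Let coef (p : (V * V) * (V * V)) := a p.1.1 p.1.2 * a p.2.1 p.2.2.

Lemma quad_sqr (T : {set V}) :
  quad a T ^+ 2 = \sum_p coef p * (quadruple p \subset T)%:R.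
Proof.
have quadE : quad a T =
    \sum_(p : V * V) a p.1 p.2 * ((p.1 \in T) && (p.2 \in T))%:R.
  rewrite /quad pair_big_dep /= [LHS]big_mkcond /=.
  by apply: eq_bigr => p _; case: ifP; rewrite ?mulr1 ?mulr0.
rewrite expr2 quadE big_distrlr pair_bigA /=.
apply: eq_bigr => -[p q] _ /=.
rewrite mulrACA -natrM mulnb /coef /quadruple /=.
by rewrite !subUset !sub1set /= -!andbA.
Qed.

Lemma sum_quad_sqr (A : {set V}) k :
  \sum_(T : {set V} | (T \subset A) && (#|T| == k)) quad a T ^+ 2 =
  \sum_p coef p *
    #|[set T : {set V} | [&& quadruple p \subset T, T \subset A & #|T| == k]]|%:R.
Proof.
under eq_bigr do rewrite quad_sqr.
rewrite exchange_big /=; apply: eq_bigr => p _.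
rewrite -big_distrr /=; congr (_ * _).
rewrite -sum1_card natr_sum big_mkcond [RHS]big_mkcond /=.
by apply: eq_bigr => T _; rewrite inE andbC; case: (_ \subset T); case: ifP.
Qed.
End SumOfSquares.

Lemma card_quadruple (V : finType) (p : (V * V) * (V * V)) :
  (0 < #|quadruple p| <= 4)%N.
Proof.
apply/andP; split; first by apply/card_gt0P; exists p.1.1; rewrite !inE eqxx.
rewrite /quadruple !cardsU !cards1; lia.
Qed.

(** * Square-sum identities on 3m + 1 vertices *)

Section QuadModThree.
Variables (V : finType) (a : V -> V -> 'Z_3) (A : {set V}) (m : nat).
Hypothesis cardA : #|A| = (3 * m + 1)%N.

(** A monomial on u vertices is counted C(3m + 1 - u, 4 - u) times. Modulo 3 this is 1 for u = 2, 3,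
    4 and m for u = 1, where the monomial is a squared diagonal entry. *)
Lemma sum_quad_sqr_quads :
  \sum_(T : {set V} | (T \subset A) && (#|T| == 4%N)) quad a T ^+ 2 =
  quad a A ^+ 2 + (m%:R - 1) * \sum_(x in A) (a x x) ^+ 2.
Proof.
have -> : \sum_(x in A) (a x x) ^+ 2 =
    \sum_(T : {set V} | (T \subset A) && (#|T| == 1%N)) quad a T ^+ 2.
  have quad1 x : quad a [set x] = a x x by rewrite /quad !big_set1.
  under [LHS]eq_bigr do rewrite -quad1.
  rewrite -(big_imset (fun T => quad a T ^+ 2)) /=; last by move=> x y _ _ /set1_inj.
  apply: eq_bigl => T; apply/imsetP/andP => [[x xA ->] | [sTA /cards1P[x Tx]]].
    by rewrite sub1set xA cards1.
  by exists x; rewrite // -sub1set -Tx.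
rewrite !sum_quad_sqr quad_sqr big_distrr /= -big_split /=.
apply: eq_bigr => p _; set U := quadruple p.
have /andP[geU1 leU4] := card_quadruple p; rewrite -/U in geU1 leU4.
have [sUA | nsUA] := boolP (U \subset A); last first.
  rewrite !eq_card0 ?mulr0 ?addr0 // => T; rewrite inE; apply/negP;
  by case/and3P=> sUT sTA _; rewrite (subset_trans sUT sTA) in nsUA.
have leUA := subset_leq_card sUA; rewrite cardA in leUA.
rewrite !card_supersets // cardA leU4 mulrCA -mulrDr; congr (_ * _).
move: leU4 geU1 leUA; case: #|U| => [|[|[|[|[|u]]]]] //= _ _ leUA.
- by rewrite subnn bin0 mulr1 addrC subrK addnK -[(3 * m)%N]addn0 Z3_bin3.
- by rewrite mulr0 addr0 (_ : (_ - _)%N = 3 * m.-1 + 2)%N ?Z3_bin2 //; lia.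
- rewrite mulr0 addr0 bin1 (_ : (_ - _)%N = 3 * m.-1 + 1)%N; last by lia.
  by rewrite natrD Z3_natr3 add0r.
- by rewrite mulr0 addr0 bin0.
Qed.

Hypothesis diag0 : forall x, a x x = 0.
(** Without diagonal terms 2 <= u <= 4, and a monomial on u vertices is counted C(3m + 1 - u, 3)
    times, which is m - 1 modulo 3. *)
Lemma sum_quad_sqr_cotriples : (1 < m)%N ->
  \sum_(T : {set V} | (T \subset A) && (#|T| == 3 * m - 2)%N) quad a T ^+ 2 =
  (m%:R - 1) * quad a A ^+ 2.
Proof.
move=> m_gt1; rewrite sum_quad_sqr quad_sqr big_distrr /=.
apply: eq_bigr => -[[x y] [z t]] _; set U := quadruple _ => /=.
have [-> | neq_xy] := eqVneq x y; first by rewrite diag0; ring.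
have /andP[_ leU4] := card_quadruple ((x, y), (z, t)); rewrite -/U in leU4.
have geU2 : (1 < #|U|)%N.
  rewrite (leq_trans _ (subset_leq_card (_ : [set x; y] \subset U))) ?cards2 ?neq_xy //.
  by rewrite subUset !sub1set !inE !eqxx ?orbT.
have [sUA | nsUA] := boolP (U \subset A); last first.
  rewrite mulr0 mulr0 eq_card0 ?mulr0 // => T; rewrite inE; apply/negP.
  by case/and3P=> sUT sTA _; rewrite (subset_trans sUT sTA) in nsUA.
rewrite card_supersets // cardA ifT; last by lia.
rewrite mulr1 mulrC; congr (_ * _).
rewrite -bin_sub; last by lia.
rewrite (_ : (_ - (_ - _ - _))%N = 3); last by lia.
have -> : (3 * m + 1 - #|U| = 3 * m.-1 + (4 - #|U|))%N by lia.
rewrite Z3_bin3; last by lia.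
by rewrite -[in RHS](prednK (ltnW m_gt1)) -natr1 addrK.
Qed.
End QuadModThree.

Lemma quad_setC (V : finType) (a : V -> V -> 'Z_3) (T : {set V}) :
  (forall x y, a x y = a y x) ->
  quad a (~: T) = quad a setT - (\sum_(x in T) \sum_y a x y) *+ 2 + quad a T.
Proof.
move=> aC.
have split2 (f : V -> 'Z_3) : \sum_(x in ~: T) f x = \sum_x f x - \sum_(x in T) f x.
  rewrite [in RHS](bigID (mem T)) /= addrC addrK.
  by apply: eq_bigl => x; rewrite inE.
have quadT : quad a setT = \sum_x \sum_y a x y.
  by apply: eq_big => [x | x _]; rewrite ?inE //; apply: eq_bigl => y; rewrite inE.
rewrite /quad -/(quad a setT) quadT split2.
under eq_bigr do rewrite split2.
rewrite sumrB; under [X in _ - X]eq_bigr do rewrite split2.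
rewrite sumrB.
have -> : \sum_x \sum_(y in T) a x y = \sum_(x in T) \sum_y a x y.
  rewrite exchange_big; apply: eq_bigr => x _ /=.
  by apply: eq_bigr => y _; rewrite aC.
by ring.
Qed.

Lemma quad_set1 (V : finType) (a : V -> V -> 'Z_3) x : quad a [set x] = a x x.
Proof. by rewrite /quad !big_set1. Qed.

Lemma quad_set0 (V : finType) (a : V -> V -> 'Z_3) : quad a set0 = 0.
Proof. by rewrite /quad big_set0. Qed.

Lemma subset_of_card (V : finType) (B : {set V}) k :
  (k <= #|B|)%N -> exists2 A : {set V}, A \subset B & #|A| = k.
Proof.
rewrite -bin_gt0 -cards_draws => /card_gt0P[A].
by rewrite inE => /andP[sAB /eqP]; exists A.
Qed.

Lemma sum_quad_sqr_neq0 (V : finType) (a : V -> V -> 'Z_3) (A : {set V}) k :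
  (forall S : {set V}, S \subset A -> #|S| = k -> quad a S != 0) ->
  \sum_(S : {set V} | (S \subset A) && (#|S| == k)) quad a S ^+ 2 =
    'C(#|A|, k)%:R.
Proof.
move=> nz; rewrite -cards_draws -sum1_card natr_sum big_mkcond [RHS]big_mkcond /=.
apply: eq_bigr => S _; rewrite inE.
by case: ifP => // /andP[sSA /eqP cS]; rewrite Z3_sqr nz.
Qed.

(** * Zero-sum sets through complements *)

Section Graph.
Variables (V : finType) (a : V -> V -> 'Z_3).
Hypothesis aC : forall x y, a x y = a y x.
Hypothesis diag0 : forall x, a x x = 0.

Lemma zero_free_cotriples (A : {set V}) m :
  #|A| = (3 * m + 1)%N -> (1 < m)%N ->
  (forall S : {set V}, S \subset A -> #|S| = (3 * m - 2)%N -> quad a S != 0) ->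
  quad a A = 0 /\ m%:R = 0 :> 'Z_3.
Proof.
move=> cA m_gt1 nz; have := sum_quad_sqr_cotriples cA diag0 m_gt1.
rewrite (sum_quad_sqr_neq0 nz) cA -bin_sub; last by lia.
rewrite (_ : (_ - _)%N = 3) ?Z3_bin3; [|by []|by lia].
rewrite Z3_sqr; have [-> -> | _] := eqVneq (quad a A) 0; first by rewrite mulr0.
by rewrite mulr1 => /eqP; rewrite -subr_eq0 opprB addrC subrK oner_eq0.
Qed.

(** This is the case m = 2: 3m - 2 = 4, and 2 is nonzero modulo 3. *)
Lemma zero_sum_K4 (A : {set V}) :
  #|A| = 7%N -> exists S : {set V}, #|S| = 4%N /\ quad a S = 0.
Proof.
move=> cA; pose P (S : {set V}) := (#|S| == 4%N) && (quad a S == 0).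
have [/existsP[S /andP[/eqP cS /eqP S0]] | /existsPn nz] := boolP [exists S, P S].
  by exists S.
have [||S _ cS|_] := @zero_free_cotriples A 2; rewrite ?cA //.
by have := nz S; rewrite /P cS eqxx.
Qed.

(* On sets T with |T| = 1 mod 3, this form takes the value of [a] on ~: T. *)
Definition codegree_form x y := if x == y then quad a [set~ x] else a x y.

(** Since F(V - x) = F(V) - 2 d(x), summing over T counts F(V) with weight |T| = 1 modulo 3, in
    agreement with [quad_setC]. *)
Lemma quad_setC_form (T : {set V}) k :
  #|T| = (3 * k + 1)%N -> quad a (~: T) = quad codegree_form T.
Proof.
move=> cT; rewrite quad_setC //.
have -> : quad codegree_form T = \sum_(x in T) quad a [set~ x] + quad a T.
  suff form_sum g : quad (fun x y => if x == y then g x else a x y) T =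
    \sum_(x in T) g x + quad a T by exact: form_sum.
  rewrite /quad -big_split /=; apply: eq_bigr => x xT.
  rewrite (bigD1 x) //= [in RHS](bigD1 x) //= diag0 add0r eqxx.
  by congr (_ + _); apply: eq_bigr => y /andP[_ /negPf]; rewrite eq_sym => ->.
congr (_ + _).
under [RHS]eq_bigr do rewrite quad_setC // quad_set1 diag0 addr0 big_set1.
rewrite sumrB sumr_const cT -[_ *+ (_ + _)]mulr_natl natrD Z3_natr3 add0r mul1r.
by rewrite sumrMnl.
Qed.

Lemma zero_sum_mod0 m :
  #|V| = (3 * m + 1)%N -> (3 <= m)%N ->
  exists S : {set V}, #|S| = (3 * m - 3)%N /\ quad a S = 0.
Proof.
move=> cV m_ge3; pose P (S : {set V}) := (#|S| == (3 * m - 3)%N) && (quad a S == 0).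
have [/existsP[S /andP[/eqP cS /eqP S0]] | /existsPn nz] := boolP [exists S, P S].
  by exists S.
pose g x := quad a [set~ x]; pose G := [set x | g x != 0].
have form_nz (T : {set V}) : #|T| = 4%N -> quad codegree_form T != 0.
  move=> cT; rewrite -(@quad_setC_form T 1) //.
  have := nz (~: T); rewrite /P negb_and => /orP[] // /negP[].
  by rewrite cardsCs setCK cT cV; apply/eqP; lia.
have sum4 (A : {set V}) k : #|A| = (3 * k + 1)%N ->
    'C(3 * k + 1, 4)%:R =
      quad codegree_form A ^+ 2 + (k%:R - 1) * \sum_(x in A) (g x) ^+ 2.
  move=> cA; have := sum_quad_sqr_quads codegree_form cA.
  rewrite (sum_quad_sqr_neq0 (fun S _ => form_nz S)) cA => ->.
  by congr (_ + _ * _); apply: eq_bigr => x _; rewrite /codegree_form eqxx.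
have sum_g (A : {set V}) : \sum_(x in A) (g x) ^+ 2 = #|A :&: G|%:R.
  rewrite -sum1_card natr_sum big_mkcond [RHS]big_mkcond /=.
  by apply: eq_bigr => x _; rewrite !inE Z3_sqr; case: (x \in A); case: eqP.
(* On a 7-set with j vertices in [G] and 3 | j, the identity makes C(7, 4) = 35 = 2 a square modulo
   3, which it is not. *)
have sept (j : nat) : (3 %| j)%N -> (j <= #|G|)%N ->
    (7 - j <= #|~: G|)%N -> (j <= 7)%N -> False.
  move=> /dvdnP[i ->] /subset_of_card[A1 sA1 cA1] /subset_of_card[A2 sA2 cA2] le7.
  have A12 : A1 :&: A2 = set0.
    by apply/setP => x; rewrite !inE; apply/negP => /andP[/(subsetP sA1) + /(subsetP sA2)];
      rewrite !inE => ->.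
  have cA : #|A1 :|: A2| = (3 * 2 + 1)%N by rewrite cardsU A12 cards0 cA1 cA2; lia.
  have bin74 : 'C(3 * 2 + 1, 4) = (3 * 11 + 2)%N by [].
  have := sum4 _ _ cA; rewrite bin74 natrD Z3_natr3 add0r.
  rewrite sum_g setIUl (setIidPl sA1) [A2 :&: _](_ : _ = set0); last first.
    by apply/setP => x; rewrite !inE; apply/negP => /andP[/(subsetP sA2)]; rewrite !inE => /negP.
  rewrite setU0 cA1 mulnC Z3_natr3 mulr0 addr0 Z3_sqr.
  by case: (_ == 0).
have g_nz x : g x != 0.
  (* Since |V| >= 10 and [~: G] is nonempty, one of j = 0, 3, 6 is available. *)
  apply/negP => gx0; have := cardsC G; rewrite cV => cG.
  have : (0 < #|~: G|)%N.
    by apply/card_gt0P; exists x; rewrite !inE negbK.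
  have := sept 6%N erefl; have := sept 3%N erefl; have := sept 0%N erefl.
  by move=> ? ? ? ?; lia.
have := sum4 setT m; rewrite cardsT => /(_ cV).
rewrite -(@quad_setC_form _ m) ?cardsT // setCT quad_set0 expr0n /= add0r sum_g.
have -> : G = setT by apply/setP => x; rewrite !inE g_nz.
rewrite setTI cardsT cV natrD Z3_natr3 add0r mulr1.
(* From 4 C(3m + 1, 4) = (3m + 1) C(3m, 3) it follows that C(3m + 1, 4) = m modulo 3. *)
have := congr1 (fun n => n%:R : 'Z_3) (mul_bin_diag (3 * m + 1) 3).
rewrite addn1 -pred_Sn -[X in 'C(X, 3)]addn0 -[4%N]/(3 * 1 + 1)%N -[(3 * m).+1]addn1.
rewrite [LHS]natrM [RHS]natrM [in LHS]natrD [in RHS]natrD.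
rewrite !Z3_natr3 !add0r !mul1r Z3_bin3 // => <-.
by move/eqP; rewrite -subr_eq0 opprB addrC subrK oner_eq0.
Qed.
End Graph.

(** * Zero-sum triangles *)

(* Row k of a labelled complete graph on 0, 1, ... lists the labels from k to
   0, ..., k - 1.  [next_rows M] lists the rows that can follow M without a
   zero-sum triangle; [no_extension n M] says that no n further rows fit, given
   that the edges from 0 to 1, 2, 3, 4 are labelled 0. *)
Definition extend_rows (rs : seq (seq nat)) (r : seq nat) : seq (seq nat) :=
  [seq rcons p l | p <- rs,
     l <- [seq l <- [:: 0; 1; 2]%N |
            all (fun q => (q.1 + q.2 + l) %% 3 != 0)%N (zip p r)]].

Definition next_rows (M : seq (seq nat)) : seq (seq nat) :=
  foldl extend_rows [:: [::]] M.

Fixpoint no_extension (n : nat) (M : seq (seq nat)) : bool :=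
  if n is n'.+1 then
    all (no_extension n' \o rcons M)
      [seq r <- next_rows M | (size M <= 4)%N ==> (head 0%N r == 0%N)]
  else false.

Section Soundness.
Variables (L : nat -> nat -> nat) (N : nat).
Hypothesis L_lt3 : forall i j, (L i j < 3)%N.
Hypothesis L_triangle : forall i j k, (i < j < k)%N -> (k < N)%N ->
  ((L k i + L j i + L k j) %% 3 != 0)%N.
Hypothesis L_base : forall k, (0 < k <= 4)%N -> L k 0 = 0%N.

Let row k := mkseq (L k) k.

Lemma mem_next_rows k : (k < N)%N -> row k \in next_rows (mkseq row k).
Proof.
move=> lt_kN; rewrite /row /next_rows.
(* After j rows the fold contains the first j entries of row k. Entry j closes the triangles i < j <
   k, whose other two labels [zip] pairs up. *)
suff: forall j, (j <= k)%N ->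
    mkseq (L k) j \in foldl extend_rows [:: [::]] (mkseq row j) by apply.
elim=> [|j IHj] lt_jk //; rewrite !mkseqS foldl_rcons.
apply: allpairs_f_dep; first exact: IHj (ltnW lt_jk).
rewrite mem_filter; apply/andP; split; last first.
  by rewrite !inE; have := L_lt3 k j; case: (L k j) => [|[|[|]]].
apply/allP => -[p q] /(nthP (0, 0)%N)[i].
rewrite size_zip !size_mkseq minnn => lt_ij.
rewrite nth_zip ?size_mkseq // !nth_mkseq // => -[<- <-] /=.
by apply: L_triangle; rewrite ?lt_ij.
Qed.

Lemma no_extensionP n k : (k + n <= N)%N -> ~~ no_extension n (mkseq row k).
Proof.
elim: n k => [|n IHn] k le_knN //=.
apply/allPn; exists (row k); last by rewrite /= -mkseqS IHn ?addSnnS.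
rewrite mem_filter mem_next_rows ?andbT; last by lia.
rewrite size_mkseq; apply/implyP; case: k {le_knN} => // k le_k4.
by rewrite /row /= L_base.
Qed.
End Soundness.

(** Exhaustive search over rows 0 to 10, row 0 being empty. *)
Lemma no_extension11 : no_extension 11 [::].
Proof. by vm_compute. Qed.

(** At least ten edges at v carry three labels, so some label occurs four times; this normalises the
    search. *)
Lemma zero_sum_triangle (V : finType) (a : V -> V -> 'Z_3) :
  (forall x y, a x y = a y x) -> (11 <= #|V|)%N ->
  exists x y z, [/\ x != y, y != z, x != z & a x y + a y z + a x z = 0].
Proof.
move=> aC V_ge11; have /card_gt0P[v _] : (0 < #|V|)%N by lia.
(* Subtracting [c] from all labels does not change sums over triangles. *)
have [c ge4] : exists c, (4 <= #|[set y | (y != v) && (a y v == c)]|)%N.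
  apply/existsP; apply: contraLR V_ge11; rewrite negb_exists => /forallP lt4.
  have : (\sum_(c : 'Z_3) #|[set y | (y != v) && (a y v == c)]| <= \sum_(c : 'Z_3) 3)%N.
    by apply: leq_sum => c _; rewrite leqNgt; apply: lt4.
  rewrite sum_nat_const card_ord -[(Zp_trunc 3).+2]/3%N; under eq_bigr do rewrite -sum1dep_card.
  rewrite -(partition_big (fun y => a y v) predT) //= sum1dep_card.
  have -> : [set y | y != v] = [set~ v] by apply/setP => y; rewrite !inE.
  by rewrite cardsC1 -leqNgt; case: #|V|.
have [C [vC aCv C_ge4]] : exists C : {set V},
    [/\ v \notin C, forall y, y \in C -> a y v = c & (4 <= #|C|)%N].
  exists [set y | (y != v) && (a y v == c)]; split=> //; first by rewrite inE eqxx.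
  by move=> y; rewrite inE => /andP[_ /eqP].
(* The order puts v at position 0 and members of [C] at positions 1 to 4, as [L_base] requires. *)
pose s := v :: enum C ++ enum (~: (v |: C)).
have size_s : size s = #|V|.
  by rewrite /= size_cat -!cardE -(cardsC (v |: C)) cardsU1 vC addSn.
have uniq_s : uniq s.
  rewrite /= cat_uniq !enum_uniq mem_cat !mem_enum !inE eqxx (negPf vC) /= andbT.
  by apply/hasPn => y; rewrite !mem_enum !inE negb_or => /andP[_ /negPf ->].
pose L i j := val (a (nth v s i) (nth v s j) - c).
pose P x y z := [&& x != y, y != z, x != z & a x y + a y z + a x z == 0].
have [/existsP[x /existsP[y /existsP[z /and4P[? ? ? /eqP]]]] | no3] :=
  boolP [exists x, exists y, exists z, P x y z]; first by exists x, y, z.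
suff: ~~ no_extension 11 [::] by rewrite no_extension11.
apply: (@no_extensionP L 11 _ _ _ 11 0) => //
  [i j | i j k /andP[lt_ij lt_jk] lt_k11 | k /andP[k_gt0 k_le4]].
- exact: ltn_ord.
- apply: contra no3 => L0.
  apply/existsP; exists (nth v s k); apply/existsP; exists (nth v s i).
  apply/existsP; exists (nth v s j).
  rewrite /P !nth_uniq ?size_s //; try lia.
  apply/and4P; split; [lia | lia | lia | ].
  have : (L k i + L j i + L k j)%:R = 0 :> 'Z_3.
    by rewrite -(divnK L0) mulnC Z3_natr3.
  rewrite !natrD !natr_Zp => L0'.
  rewrite -[X in _ == X]L0' -[X in _ == X]addr0 -[X in _ == _ + X](mul0r c) -Z3_3.
  rewrite (aC (nth v s j)).
  by apply/eqP; ring.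
- rewrite /L; have -> : nth v s k = nth v (enum C) k.-1.
    by case: k k_gt0 k_le4 => // k _ lt_k4; rewrite /= nth_cat -cardE (leq_trans lt_k4).
  have : nth v (enum C) k.-1 \in C.
    by rewrite -mem_enum mem_nth // -cardE; lia.
  by move/aCv => ->; rewrite subrr.
Qed.

(** * Upper bounds for n = 1 modulo 3 and for n = 3, 7 *)

Section CompleteGraphs.
Variables (V : finType) (a : V -> V -> 'Z_3).
Hypothesis aC : forall x y, a x y = a y x.
Hypothesis diag0 : forall x, a x x = 0.

Lemma zero_sum_mod1 m :
  #|V| = (3 * m + 1)%N -> (3 < m)%N ->
  exists S : {set V}, #|S| = (3 * m - 2)%N /\ quad a S = 0.
Proof.
move=> cV m_gt3; pose P (S : {set V}) := (#|S| == (3 * m - 2)%N) && (quad a S == 0).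
have [/existsP[S /andP[/eqP cS /eqP S0]] | /existsPn nz] := boolP [exists S, P S].
  by exists S.
have [||S _ cS|aV _] := @zero_free_cotriples V a diag0 setT m; rewrite ?cardsT //; first lia.
  by have := nz S; rewrite /P cS eqxx.
pose d x := \sum_y a x y.
(* As F(V) = 0, F(~: T) is 2 e(T) - 2 D, with e(T) the edge sum and D the degree sum over T. Modulo
   3 this equals 2 (e(T) + 2 D), and a triangle meets each of its vertices in two edges. *)
have [|| x [y [z [xy yz xz bxyz]]]] := @zero_sum_triangle V (fun x y => a x y + d x + d y).
- by move=> x y; rewrite aC; ring.
- by rewrite cV; lia.
pose T := x |: (y |: [set z]).
have xT : x \notin y |: [set z] by rewrite !inE negb_or xy xz.
have yT : y \notin [set z] by rewrite inE.
exists (~: T); split.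
  by rewrite cardsCs setCK cV !cardsU1 xT yT cards1; lia.
rewrite quad_setC // aV /quad !(big_setU1 _ xT, big_setU1 _ yT, big_set1) /=.
rewrite !diag0 (aC y x) (aC z x) (aC z y) -!/(d _).
rewrite [LHS](_ : _ = 2%:R * (a x y + d x + d y + (a y z + d y + d z) +
  (a x z + d x + d z)) - 3%:R * (2%:R * (d x + d y + d z))); last by ring.
by rewrite bxyz Z3_3 mulr0 mul0r subr0.
Qed.

Lemma zero_sum_K3 : (11 <= #|V|)%N -> exists S : {set V}, #|S| = 3%N /\ quad a S = 0.
Proof.
move=> /(zero_sum_triangle aC)[x [y [z [xy yz xz sum0]]]].
exists (x |: (y |: [set z])).
have xT : x \notin y |: [set z] by rewrite !inE negb_or xy xz.
have yT : y \notin [set z] by rewrite inE.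
rewrite !cardsU1 xT yT cards1; split=> //.
rewrite /quad !(big_setU1 _ xT, big_setU1 _ yT, big_set1) /= !diag0.
rewrite (aC y x) (aC z x) (aC z y).
rewrite [LHS](_ : _ = 2%:R * (a x y + a y z + a x z)); last by ring.
by rewrite sum0 mulr0.
Qed.

Lemma zero_sum_K7 : #|V| = 11%N -> exists S : {set V}, #|S| = 7%N /\ quad a S = 0.
Proof.
move=> cV; pose P (S : {set V}) := (#|S| == 7%N) && (quad a S == 0).
have [/existsP[S /andP[/eqP cS /eqP S0]] | /existsPn nz] := boolP [exists S, P S].
  by exists S.
(* V - x has 10 = 3 * 3 + 1 vertices, and 7 = 3 * 3 - 2. *)
have quad_D1 x : quad a [set~ x] = 0.
  have [||S _ cS|] // := @zero_free_cotriples V a diag0 [set~ x] 3.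
    by rewrite cardsC1 cV.
  by have := nz S; rewrite /P cS eqxx.
have [|A _ cA] := @subset_of_card V setT 7; first by rewrite cardsT cV.
have [T [cT T0]] := zero_sum_K4 diag0 cA.
exists (~: T); split; first by rewrite cardsCs setCK cV cT.
rewrite (@quad_setC_form _ _ aC diag0 _ 1) // -T0 /quad.
apply: eq_bigr => x _; apply: eq_bigr => y _; rewrite /codegree_form quad_D1.
by case: eqP => // ->.
Qed.

Lemma sum_quad_pairs (S : {set V}) :
  \sum_(e : {set V} | (e \subset S) && (#|e| == 2%N)) quad a e = quad a S.
Proof.
have quadE (e : {set V}) : quad a e = \sum_x \sum_y a x y * ([set x; y] \subset e)%:R.
  rewrite /quad big_mkcond; apply: eq_bigr => x _.
  case: ifPn => xe; last first.
    by rewrite big1 // => y _; rewrite subUset !sub1set (negPf xe) mulr0.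
  rewrite big_mkcond; apply: eq_bigr => y _.
  by rewrite subUset !sub1set xe; case: (y \in e); rewrite ?mulr1 ?mulr0.
under eq_bigr do rewrite quadE.
rewrite exchange_big quadE; apply: eq_bigr => x _.
rewrite exchange_big; apply: eq_bigr => y _ /=.
rewrite -big_distrr /=.
have [-> | neq_xy] := eqVneq x y; first by rewrite diag0 !mul0r.
congr (_ * _).
transitivity (#|[set e : {set V} |
  [&& [set x; y] \subset e, e \subset S & (#|e| == 2)%N]]|%:R : 'Z_3).
  rewrite -sum1_card natr_sum big_mkcond [RHS]big_mkcond /=.
  by apply: eq_bigr => e _; rewrite inE andbC; case: (_ \subset e); case: ifP.
case: (boolP ([set x; y] \subset S)) => [sS | nsS].
  by rewrite card_supersets // cards2 neq_xy /= bin0.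
rewrite eq_card0 // => e; rewrite inE; apply/negP => /and3P[se eS _].
by rewrite (subset_trans se eS) in nsS.
Qed.
End CompleteGraphs.

(** * Copies of complete graphs *)

Lemma mem_edges_complete m (e : {set complete_graph m}) :
  (e \in edges (complete_graph m)) = (#|e| == 2)%N.
Proof.
rewrite inE; apply/existsP/cards2P => [[x /existsP[y /andP[xy /eqP ->]]] | [x [y [xy ->]]]].
  by exists x, y.
by exists x; apply/existsP; exists y; rewrite eqxx andbT.
Qed.

Lemma imset_edges_complete n N (f : complete_graph n -> complete_graph N) :
  injective f ->
  [set f @: e | e : {set complete_graph n} in edges (complete_graph n)] =
  [set e : {set complete_graph N} | (e \subset f @: setT) && (#|e| == 2)%N].
Proof.
move=> f_inj; apply/setP => e; rewrite inE.
apply/imsetP/andP => [[e1] | [/subsetP se ce]].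
  by rewrite mem_edges_complete => ce1 ->; rewrite imsetS ?subsetT // card_imset.
have fK : f @: (f @^-1: e) = e.
  apply/setP => x; apply/imsetP/idP => [[y + ->] | xe]; first by rewrite inE.
  by have /imsetP[y _ xE] := se x xe; exists y; rewrite // inE -xE.
exists (f @^-1: e); rewrite ?fK // mem_edges_complete.
by rewrite -(card_imset _ f_inj) fK.
Qed.

Lemma copy_completeP n N (S : {set complete_graph N}) E :
  is_copy (complete_graph n) S E <->
  #|S| = n /\ E = [set e : {set complete_graph N} | (e \subset S) && (#|e| == 2)%N].
Proof.
split=> [[_ [f [f_inj <- <-]]] | [cS ->]].
  by rewrite imset_edges_complete // card_imset // cardsT card_ord.
split; first by apply/subsetP => e; rewrite inE mem_edges_complete => /andP[].
pose f (i : complete_graph n) : complete_graph N := enum_val (cast_ord (esym cS) i).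
have f_inj : injective f by move=> i j /enum_val_inj /cast_ord_inj.
have fS : f @: setT = S.
  apply/eqP; rewrite eqEcard card_imset // cardsT card_ord cS leqnn andbT.
  by apply/subsetP => _ /imsetP[i _ ->]; apply: enum_valP.
by exists f; rewrite imset_edges_complete // fS.
Qed.

(** Symmetric matrices with zero diagonal replace edge labellings. Since 2 is invertible, [quad] and
    the edge sum have the same zeros. *)
Definition unavoidable n N := forall a : 'I_N -> 'I_N -> 'Z_3,
  (forall x y, a x y = a y x) -> (forall x, a x x = 0) ->
  exists S : {set 'I_N}, #|S| = n /\ quad a S = 0.

(** The sign cancels the factor 2 = -1 in [quad], so [w] is the labelling given by [a]. *)
Lemma sum_edges_complete N (w : edge_type (complete_graph N) -> 'Z_3)
    (a : 'I_N -> 'I_N -> 'Z_3) (S : {set 'I_N}) :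
  (forall x, a x x = 0) -> (forall e, w e = - quad a (val e)) ->
  \sum_(e | val e \in [set e : {set complete_graph N} | (e \subset S) && (#|e| == 2)%N]) w e =
  - quad a S.
Proof.
move=> diag0 wE; under eq_bigr do rewrite wE.
rewrite sumrN; congr (- _); set pairs := [set e | _].
transitivity (\sum_(e in edges (complete_graph N) | e \in pairs) quad a e).
  by rewrite big_sub_cond.
rewrite -(sum_quad_pairs diag0); apply: eq_bigl => e.
by rewrite mem_edges_complete inE andbA andbAC andbb andbC.
Qed.

Lemma unavoidableP n N :
  zero_sum_unavoidable (complete_graph n) N <-> unavoidable n N.
Proof.
split=> [unav a aC diag0 | unav w].
  have [S [E [/copy_completeP[cS ->] sum0]]] := unav (fun e => - quad a (val e)).
  exists S; split=> //; apply: oppr_inj; rewrite oppr0 -sum0.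
  by rewrite (@sum_edges_complete _ _ a).
(* The default 0 is taken only for x = y, where the set is a singleton. *)
pose a (x y : 'I_N) := if insub [set x; y] is Some e then w e else 0.
have aC x y : a x y = a y x by rewrite /a setUC.
have diag0 x : a x x = 0.
  by rewrite /a insubN // mem_edges_complete setUid cards1.
have [S [cS S0]] := unav a aC diag0.
exists S, [set e : {set complete_graph N} | (e \subset S) && (#|e| == 2)%N].
split; first exact/copy_completeP.
rewrite (@sum_edges_complete _ _ a) ?S0 ?oppr0 // => e.
have := valP e; rewrite mem_edges_complete => /cards2P[x [y [xy eE]]].
have axy : a x y = w e by rewrite /a -eE valK.
have xNy : x \notin [set y] by rewrite inE.
rewrite eE /quad !(big_setU1 _ xNy, big_set1) /= !diag0 (aC y x) axy add0r addr0.
rewrite [RHS](_ : _ = w e - 3%:R * w e); last by ring.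
by rewrite Z3_3 mul0r subr0.
Qed.

Lemma unavoidable_mono n N N' : (N <= N')%N -> unavoidable n N -> unavoidable n N'.
Proof.
move=> le_NN' unav a aC diag0; pose f := widen_ord le_NN'.
have f_inj : injective f by move=> i j /(congr1 val) /= /val_inj.
have [S [cS S0]] := unav (fun x y => a (f x) (f y)) (fun x y => aC _ _) (fun x => diag0 _).
exists (f @: S); split; first by rewrite card_imset.
rewrite -S0 /quad big_imset /=; last by move=> x y _ _; apply: f_inj.
by apply: eq_bigr => x _; rewrite big_imset //= => y z _ _; apply: f_inj.
Qed.

(* The diagonal of a labelling is irrelevant, so [b] may have one. *)
Lemma avoidable n N (b : 'I_N -> 'I_N -> 'Z_3) :
  (forall x y, b x y = b y x) ->
  (forall S : {set 'I_N}, #|S| = n -> quad b S != \sum_(x in S) b x x) ->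
  ~ unavoidable n N.
Proof.
move=> bC nz unav.
have [||S [cS S0]] := unav (fun x y => if x == y then 0 else b x y).
- by move=> x y; rewrite eq_sym bC.
- by move=> x; rewrite eqxx.
have /eqP[] := nz S cS.
transitivity (\sum_(x in S) b x x +
  quad (fun x y => if x == y then 0 else b x y) S).
  rewrite /quad -big_split /=;
  apply: eq_bigr => x xS; rewrite (bigD1 x) //= [X in _ = _ + X](bigD1 x) //= eqxx add0r.
  by congr (_ + _); apply: eq_bigr => y /andP[_ /negPf]; rewrite eq_sym => ->.
by rewrite S0 addr0.
Qed.

(** By monotonicity, avoidance at r - 1 settles every N < r. *)
Lemma ramseyP n r : unavoidable n r -> ~ unavoidable n r.-1 ->
  is_zero_sum_ramsey (complete_graph n) r.
Proof.
move=> unav avoid; split; first exact/unavoidableP.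
move=> N /unavoidableP unavN; rewrite leqNgt; apply/negP => lt_Nr.
by apply: avoid; apply: unavoidable_mono unavN; lia.
Qed.

(** Block labellings are sums of such products, so F(S) depends only on how many vertices of S each
    block contains. *)
Lemma quad_prod N (f g : 'I_N -> 'Z_3) (S : {set 'I_N}) :
  quad (fun x y => f x * g y) S = (\sum_(x in S) f x) * (\sum_(x in S) g x).
Proof. by rewrite /quad big_distrlr. Qed.

Lemma quadD (V : finType) (a b : V -> V -> 'Z_3) (S : {set V}) :
  quad (fun x y => a x y + b x y) S = quad a S + quad b S.
Proof. by rewrite /quad -big_split; apply: eq_bigr => x _; rewrite -big_split. Qed.

(** * Lower bounds *)

Lemma card_ord_leq_size N (A : {set 'I_N}) (s : seq nat) :
  (forall x, x \in A -> (x : nat) \in s) -> (#|A| <= size s)%N.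
Proof.
move=> sAs; rewrite cardE -(size_map val); apply: uniq_leq_size.
  by rewrite map_inj_uniq ?enum_uniq //; apply: val_inj.
by move=> _ /mapP[x + ->]; rewrite mem_enum; apply: sAs.
Qed.

Section Blocks.
Variable N : nat.
Definition block0 (x : 'I_N) : 'Z_3 := (x < 2)%N%:R.
Definition block1 (x : 'I_N) : 'Z_3 := (2 <= x < 4)%N%:R.
Definition block2 (x : 'I_N) : 'Z_3 := (4 <= x)%N%:R.

Lemma block_counts (S : {set 'I_N}) : (4 <= N)%N ->
  exists i j r : nat, [/\ (i <= 2)%N, (j <= 2)%N, (r <= N - 4)%N, (i + j + r)%N = #|S| &
    [/\ \sum_(x in S) block0 x = i%:R, \sum_(x in S) block1 x = j%:R
      & \sum_(x in S) block2 x = r%:R]].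
Proof.
move=> N_ge4.
have countE (P : pred nat) :
    \sum_(x in S) (P x)%:R = #|[set x : 'I_N in S | P x]|%:R :> 'Z_3.
  rewrite -sum1_card natr_sum big_mkcond [RHS]big_mkcond /=.
  by apply: eq_bigr => x _; rewrite inE; case: (x \in S); case: (P x).
exists #|[set x : 'I_N in S | (x < 2)%N]|, #|[set x : 'I_N in S | (2 <= x < 4)%N]|.
exists #|[set x : 'I_N in S | (4 <= x)%N]|; split.
- apply: (@card_ord_leq_size _ _ [:: 0; 1]%N) => x; rewrite !inE => /andP[_].
  by case: (nat_of_ord x) => [|[]].
- apply: (@card_ord_leq_size _ _ [:: 2; 3]%N) => x; rewrite !inE => /andP[_].
  by case: (nat_of_ord x) => [|[|[|[]]]].
- rewrite -[X in (_ <= X)%N](size_iota 4); apply: card_ord_leq_size => x.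
  by rewrite !inE mem_iota subnKC // ltn_ord andbT => /andP[].
- rewrite -!sum1_card !(big_mkcond (fun x => x \in [set _ | _])) [RHS]big_mkcond.
  rewrite -!big_split; apply: eq_bigr => x _ /=; rewrite !inE.
  by case: (x \in S) => //=; case: (nat_of_ord x) => [|[|[|[|]]]].
- by split; [exact: (countE (fun x => x < 2)%N) | exact: (countE (fun x => 2 <= x < 4)%N)
    | exact: (countE (fun x => 4 <= x)%N)].
Qed.
End Blocks.

(* With blocks {0, 1}, {2, 3} and the rest, a set meeting the first two blocks in
   i and j vertices has edge sum i^2 + j^2. *)
Lemma avoidable_mod0 n : (0 < n)%N -> (3 %| n)%N -> ~ unavoidable n (n + 3).
Proof.
move=> n_gt0 n3; pose N := (n + 3)%N.
pose b (x y : 'I_N) := (block0 x * block1 y + block1 x * block0 y) +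
  ((- (block0 x + block1 x)) * block2 y + block2 x * (- (block0 y + block1 y))).
apply: (@avoidable _ _ b) => [x y | S cS]; first by rewrite /b; ring.
have [|i [j [r [i2 j2 rN ijr [Si Sj Sr]]]]] := block_counts S; first by rewrite /N; lia.
rewrite big1 => [|x xS]; last first.
  rewrite /b /block0 /block1 /block2.
  by case: (nat_of_ord x) => [|[|[|[|k]]]] /=; apply/eqP.
rewrite /b !quadD !quad_prod sumrN big_split /= Si Sj Sr.
have rE : r%:R = - (i%:R + j%:R) :> 'Z_3.
  apply/eqP; rewrite -addr_eq0 addrC -!natrD ijr cS -(divnK n3) mulnC.
  by rewrite Z3_natr3.
rewrite rE.
(* The third block has only n - 1 vertices. For i, j <= 2 not both 0, i^2 + j^2 is nonzero modulo
   3. *)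
have: (0 < i + j)%N by rewrite /N in rN; lia.
by case: i i2 {Si ijr rE} => [|[|[|i]]] // _; case: j j2 {Sj} => [|[|[|j]]].
Qed.

(* Edges inside a block have label 1; N = 0 mod 3 makes each block of size 2 mod 3. *)
Lemma avoidable_mod1 n : (4 <= n)%N -> (n %% 3 = 1)%N -> ~ unavoidable n (n + 2).
Proof.
move=> n_ge4 n1; pose N := (n + 2)%N.
pose b (x y : 'I_N) :=
  block0 x * block0 y + block1 x * block1 y + block2 x * block2 y.
apply: (@avoidable _ _ b) => [x y | S cS]; first by rewrite /b; ring.
have [|i [j [r [i2 j2 rN ijr [Si Sj Sr]]]]] := block_counts S; first by rewrite /N; lia.
have n1' : n%:R = 1 :> 'Z_3 by rewrite (divn_eq n 3) n1 natrD mulnC Z3_natr3 add0r.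
rewrite (eq_bigr (fun=> 1)) => [|x xS]; last first.
  rewrite /b /block0 /block1 /block2.
  by case: (nat_of_ord x) => [|[|[|[|k]]]] /=; apply/eqP.
rewrite sumr_const cS n1' /b !quadD !quad_prod Si Sj Sr.
have -> : r%:R = 1 - (i%:R + j%:R) :> 'Z_3.
  by apply/eqP; rewrite eq_sym subr_eq addrC -!natrD ijr cS n1'.
(* The third block has only n - 2 vertices. For each remaining pair, i^2 + j^2 + (1 - i - j)^2
   differs from the diagonal sum 1. *)
have: (2 <= i + j)%N by rewrite /N in rN; lia.
by case: i i2 {Si ijr} => [|[|[|i]]] // _; case: j j2 {Sj} => [|[|[|j]]].
Qed.

(* The 5-cycle and its complement are labelled 1 and 2 on residues mod 5; the two
   vertices in the same residue class are joined by label 0. *)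
Definition pentagon_label (i j : nat) : nat :=
  nth 0%N [:: 0; 1; 2; 2; 1]%N ((i %% 5 + 5 - j %% 5) %% 5).

Definition pentagon (x y : 'I_10) : 'Z_3 := (pentagon_label x y)%:R.

Lemma pentagonC x y : pentagon x y = pentagon y x.
Proof.
have : all (fun i => all (fun j => pentagon_label i j == pentagon_label j i)
  (iota 0 10)) (iota 0 10) by vm_compute.
move/allP/(_ x); rewrite mem_iota ltn_ord => /(_ isT)/allP/(_ y).
by rewrite mem_iota ltn_ord /pentagon => /(_ isT)/eqP ->.
Qed.

Lemma pentagon_xx x : pentagon x x = 0.
Proof. by rewrite /pentagon /pentagon_label addnC addnK. Qed.

(** Each vertex has four edges labelled 1 and four labelled 2, with total 12. *)
Lemma pentagon_regular x : \sum_y pentagon x y = 0.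
Proof.
rewrite /pentagon -natr_sum -(big_mkord predT (fun y => pentagon_label x y)).
have : all (fun i => 3 %| sumn [seq pentagon_label i j | j <- iota 0 10])%N
  (iota 0 10) by vm_compute.
move/allP/(_ x); rewrite mem_iota ltn_ord => /(_ isT).
by rewrite sumnE big_map /index_iota subn0 => /dvdnP[k ->]; rewrite mulnC Z3_natr3.
Qed.

(** Three labels sum to 0 only if all equal or all distinct. The 5-cycle and its complement are
    triangle-free, and a 0-edge joins twins, whose labels to a third vertex are equal and
    nonzero. *)
Lemma pentagon_triple (T : {set 'I_10}) : #|T| = 3%N -> quad pentagon T != 0.
Proof.
have check : all (fun i => all (fun j => all (fun k =>
    [&& i != j, i != k & j != k] ==>
    (((pentagon_label i j + pentagon_label i k + pentagon_label j k) * 2) %% 3 != 0)%N)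
  (iota 0 10)) (iota 0 10)) (iota 0 10) by vm_compute.
rewrite cardE /quad -big_enum; under eq_bigr do rewrite -big_enum.
case: (enum T) (enum_uniq T) => [|x [|y [|z []]]] //= uxyz _.
move/allP/(_ x): check; rewrite mem_iota ltn_ord => /(_ isT)/allP/(_ y).
rewrite mem_iota ltn_ord => /(_ isT)/allP/(_ z).
rewrite mem_iota ltn_ord => /(_ isT)/implyP.
rewrite !inE negb_or andbT -andbA -!val_eqE /= in uxyz.
move/(_ uxyz) => nz.
rewrite !(big_cons, big_nil) !pentagon_xx.
rewrite (pentagonC y x) (pentagonC z x) (pentagonC z y).
rewrite [X in X != 0](_ : _ =
  ((pentagon_label x y + pentagon_label x z + pentagon_label y z) * 2)%:R); last first.
  rewrite natrM !natrD /pentagon; ring.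
apply: contra nz => /eqP/(congr1 val) /=; rewrite val_Zp_nat // => ->.
by [].
Qed.

Lemma avoidable_K3 : ~ unavoidable 3 10.
Proof.
apply: (avoidable pentagonC) => S cS.
by rewrite big1 ?pentagon_triple // => x _; apply: pentagon_xx.
Qed.

(** All weighted degrees vanish, so F agrees on a 7-set and its complementary triple. *)
Lemma avoidable_K7 : ~ unavoidable 7 10.
Proof.
apply: (avoidable pentagonC) => S cS.
rewrite big1 => [|x _]; last exact: pentagon_xx.
rewrite -[S]setCK (quad_setC _ pentagonC).
rewrite [quad _ setT]big1 => [|x _]; last first.
  by rewrite -[RHS](pentagon_regular x); apply: eq_bigl => y; rewrite inE.
rewrite big1 => [|x _]; last exact: pentagon_regular.
by rewrite mul0rn subr0 add0r pentagon_triple // cardsCs setCK cS card_ord.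
Qed.

(* The Ramsey numbers *)
Local Close Scope ring_scope.

Theorem corollary1p4 (n : nat) (hn : 3 <= n) (h3 : 3 %| 'C(n, 2)) :
  [/\ n = 3 \/ n = 7 -> is_zero_sum_ramsey (complete_graph n) 11,
      6 <= n -> n = 0 %[mod 3] ->
        is_zero_sum_ramsey (complete_graph n) (n + 4)
    & 4 <= n -> n = 1 %[mod 3] -> n <> 7 ->
        is_zero_sum_ramsey (complete_graph n) (n + 3)].
Proof.
split.
- case=> ->.
    apply: (@ramseyP 3 11 _ avoidable_K3) => a aC diag0.
    by apply: zero_sum_K3; rewrite ?card_ord.
  apply: (@ramseyP 7 11 _ avoidable_K7) => a aC diag0.
  by apply: zero_sum_K7; rewrite ?card_ord.
- move=> n_ge6 /eqP; rewrite mod0n -/(3 %| n)%N => n3.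
  apply: ramseyP; last by rewrite addnS; apply: avoidable_mod0; lia.
  move=> a aC diag0; have [m nE] : exists m, n = (3 * m)%N by exists (n %/ 3)%N; lia.
  (* For n = 3m: n + 4 = 3 (m + 1) + 1 and n = 3 (m + 1) - 3. *)
  have [||S [cS S0]] := @zero_sum_mod0 _ a aC diag0 m.+1; first by rewrite card_ord; lia.
    by lia.
  by exists S; rewrite cS; split=> //; lia.
- move=> n_ge4 n1 n_neq7; change (n %% 3 = 1) in n1.
  apply: ramseyP; last by rewrite addnS; apply: avoidable_mod1.
  move=> a aC diag0; have [m nE] : exists m, n = (3 * m + 1)%N by exists (n %/ 3)%N; lia.
  have [n4 | n_neq4] := eqVneq n 4%N.
    have [|S [cS S0]] := @zero_sum_K4 _ a diag0 setT; last by exists S; split; rewrite ?cS.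
    by rewrite cardsT card_ord n4.
  (* For n = 3m + 1: n + 3 = 3 (m + 1) + 1 and n = 3 (m + 1) - 2. Excluding 4 and 7 leaves n >= 10,
     so m + 1 > 3. *)
  have [||S [cS S0]] := @zero_sum_mod1 _ a aC diag0 m.+1; first by rewrite card_ord; lia.
    by lia.
  by exists S; rewrite cS; split=> //; lia.
Qed.
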